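(* Let $n\ge 2$ and let $M\in\mathbb{C}^{n\times n}$ be transverse and proper, and suppose that every diagonal entry of $M$ equals $1$. For each inverse eigenvector $\alpha\in\mathcal{I}(M)$ define $$c(\alpha)=\frac{1}{\det\bigl(I_n+\mathrm{D}(\alpha)M\mathrm{D}(\alpha)\bigr)}.$$ Then $$\sum_{\alpha\in\mathcal{I}(M)}c(\alpha)=1\qquad\text{and}\qquad \sum_{\alpha\in\mathcal{I}(M)}c(\alpha)\,\alpha\otimes\alpha=I_n.$$
   Context: For $M=(m_{kj})\in\mathbb{C}^{n\times n}$, the set of inverse eigenvectors is $\mathcal{I}(M)=\{\alpha\in\mathbb{C}^n:\ \alpha_k\sum_{j}m_{kj}\alpha_j=1 \text{ for every } k\in\{1,\dots,n\}\}$ (equivalently, $\alpha$ has nonzero coordinates and $M\alpha=\alpha^{-1}$, the inverse taken coordinatewise). It is the zero set of the polynomial map $f_M:\mathbb{C}^n\to\mathbb{C}^n$, $f_M=(f_{M,1},\dots,f_{M,n})$, $f_{M,k}(x)=x_k(Mx)_k-1$. $M$ is called transverse if $0$ is a regular value of $f_M$, i.e. the (holomorphic) Jacobian determinant of $f_M$ is nonzero at every $\alpha\in\mathcal{I}(M)$; in this case $\mathcal{I}(M)$ is finite and the determinants in the definition of $c(\alpha)$ are nonzero. $M$ is called proper if $|f_M(x)|\to\infty$ as $|x|\to\infty$, equivalently $f_M^{-1}(C)$ is compact for every compact $C\subset\mathbb{C}^n$. $\mathrm{D}(x)$ denotes the diagonal matrix with diagonal $x$, $I_n$ is the identity matrix,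 and $x\otimes y=xy^\top$ (bilinear, no conjugation). *)

(* Defs.v *)
(* The field of complex numbers is R[i] for R : realType. *)
From HB Require Import structures.
From mathcomp Require Import all_boot all_order all_algebra.
From mathcomp Require Import all_classical all_reals all_analysis.
From mathcomp Require Import complex.

Set Implicit Arguments.
Unset Strict Implicit.
Unset Printing Implicit Defensive.

Import Order.TTheory GRing.Theory Num.Theory.
Import numFieldNormedType.Exports.

Local Open Scope classical_set_scope.
Local Open Scope ring_scope.
Local Open Scope complex_scope.

(* Vectors of C^n are row vectors, so that diag_mx and the Jacobian 'J of the
   libraries apply to them directly; (M x)_k is \sum_j M k j * x 0 j. *)
Definition inverse_eigenvectors (R : realType) (n : nat) (M : 'M[R[i]]_n) :
    set 'rV[R[i]]_n :=
  [set a | forall k, a 0 k * (\sum_j M k j * a 0 j) = 1].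

Definition inveig_map (R : realType) (n : nat) (M : 'M[R[i]]_n)
    (x : 'rV[R[i]]_n) : 'rV[R[i]]_n :=
  \row_k (x 0 k * (\sum_j M k j * x 0 j) - 1).

(* 'J is the Jacobian matrix of the C-linear differential, i.e. the holomorphic
   one, transposed because it acts on row vectors (same determinant). *)
Definition transverse_mx (R : realType) (n : nat) (M : 'M[R[i]]_n) : Prop :=
  forall a, a \in inverse_eigenvectors M -> \det ('J (inveig_map M) a) != 0.

(* normc is the R-valued modulus: the norm `|z| of R[i] has values in R[i]. *)
Definition hnorm (R : realType) (n : nat) (x : 'rV[R[i]]_n) : R :=
  Num.sqrt (\sum_k ComplexField.Normc.normc (x 0 k) ^+ 2).

Definition proper_mx (R : realType) (n : nat) (M : 'M[R[i]]_n) : Prop :=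
  forall A : R, exists B : R, forall x : 'rV[R[i]]_n,
    B <= hnorm x -> A <= hnorm (inveig_map M x).

Definition inveig_weight (R : realType) (n : nat) (M : 'M[R[i]]_n)
    (a : 'rV[R[i]]_n) : R[i] :=
  1 / \det (1%:M + diag_mx a *m M *m diag_mx a).

(* Bilinear: no complex conjugation. *)
Definition outer (R : realType) (n : nat) (x y : 'rV[R[i]]_n) : 'M[R[i]]_n :=
  x^T *m y.

(* Main.v *)
Require Import Defs.
From HB Require Import structures.
From mathcomp Require Import all_boot all_order all_algebra.
From mathcomp Require Import perm spectral.
From mathcomp Require Import all_classical all_reals all_analysis.
From mathcomp Require Import complex.

Set Implicit Arguments.
Unset Strict Implicit.
Unset Printing Implicit Defensive.

Import Order.TTheory GRing.Theory Num.Theory.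
Import numFieldNormedType.Exports.

Local Open Scope classical_set_scope.
Local Open Scope ring_scope.
Local Open Scope complex_scope.

(** Writing f_k(x) = x_k (Mx)_k - 1, the ring A = C[x] / (f_1, .., f_n) carries
    the linear form lambda reading off the constant term, once every class is
    written in squarefree monomials x_S (S a subset of the index set).  Both
    identities are instances of one fact, that lambda is evaluation at the
    solutions weighted by c:
      lambda (x_S x_T) = sum_alpha c(alpha) alpha_S alpha_T,
    where the left-hand side is 1 / det M_SS if S = T and 0 otherwise.  The case
    S = T = {} is the first identity and the case S = {i}, T = {j} the second
    one, as M_ii = 1.

    Properness says exactly that the forms x_k (Mx)_k have no common zero but
    0, hence that every principal minor det M_SS is nonzero
    ([proper_no_isotropic], [principal_mx_unit]).  This makes it possible to
    write down A without dividing polynomials: on the space with basis the x_S,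
    the products x_k x_S (k in S) are forced by the linear system with matrix
    M_SS that the relations impose, and the resulting operators [mult k] commute
    ([mult_comm]) and satisfy the relations ([mult_quadric]).

    Each solution alpha gives a common right eigenvector [eval_vec alpha],
    namely evaluation at alpha.  The key point is that the diagonal matrix G of
    principal minors makes all the [mult k] self-adjoint ([minors_mult_sym]).
    So the evaluation vectors of distinct solutions are G-orthogonal, while
    w^T G w = sum_S det M_SS alpha_S^2 = det (I + D(alpha) M D(alpha))
    for w = [eval_vec alpha] ([minors_eval_norm]), which transversality makes
    nonzero.  Hence Q = sum_alpha c(alpha) w w^T G is a projection commuting
    with the [mult k].  If Q were not the identity, 1 - Q would
    contain a common left eigenvector; the eigenvalues form a solution beta,
    self-adjointness makes the vector proportional to (eval_vec beta)^T G, and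
    pairing it with [eval_vec beta] contradicts w^T G w != 0.  So Q = 1
    ([eval_resolution]), and the entries of Q = 1 are the formula for
    lambda (x_S x_T). *)

(** * Symmetric difference with a singleton *)

Section Toggle.
Variable T : finType.
Implicit Types (S : {set T}) (k l : T).

Definition toggle S k : {set T} := if k \in S then S :\ k else k |: S.

Lemma in_toggle S k i : (i \in toggle S k) = (i == k) (+) (i \in S).
Proof.
by rewrite /toggle; case: ifP => kS; rewrite !inE; case: eqVneq => [->|_] //=;
  rewrite kS.
Qed.

Lemma toggleK k : involutive (toggle^~ k).
Proof. by move=> S; apply/finset.setP => i; rewrite !in_toggle addbA addbb. Qed.

End Toggle.

(** * The algebra of the system x_k (Mx)_k = 1 *)

Section QuotientAlgebra.
Variables (F : fieldType) (n : nat) (M : 'M[F]_n).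
Implicit Types (S : {set 'I_n}) (k l : 'I_n) (a b : 'rV[F]_n).

Definition solution a : Prop := forall k, a 0 k * (\sum_j M k j * a 0 j) = 1.

Local Notation N := #|{set 'I_n}|.

(** The principal submatrix M_SS, completed by rows of the identity so that all
    S share one matrix type.  The rows of S keep their entries outside S: this
    changes neither the determinant nor invertibility, and lets one system cover
    both ways of multiplying a monomial by a variable. *)
Definition principal_mx S : 'M[F]_n :=
  \matrix_(k, j) if k \in S then M k j else (k == j)%:R.

Lemma principal_mxE (V : lmodType F) S (Y : 'I_n -> V) k :
  \sum_j principal_mx S k j *: Y j =
  if k \in S then \sum_j M k j *: Y j else Y k.
Proof.
case: ifPn => kS.
  by apply: eq_bigr => j _; rewrite mxE kS.
rewrite (bigD1 k) //= mxE (negPf kS) eqxx scale1r big1 ?addr0 // => j jk.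
by rewrite mxE (negPf kS) eq_sym (negPf jk) scale0r.
Qed.

(** A kernel vector of [principal_mx S] vanishes outside S and has (Mx)_k = 0 on
    S, so it is a common zero of the forms x_k (Mx)_k. *)
Lemma principal_mx_unit S :
  (forall x : 'rV_n, (forall k, x 0 k * (\sum_j M k j * x 0 j) = 0) -> x = 0) ->
  principal_mx S \in unitmx.
Proof.
move=> Mreg; rewrite -unitmx_tr -row_free_unit -kermx_eq0.
apply/rowV0P => x /sub_kermxP xA; apply: Mreg => k.
have /rowP/(_ k) := xA; rewrite !mxE.
under eq_bigr => j _ do rewrite mxE mulrC.
have /= -> := @principal_mxE F^o S (fun j => x 0 j) k.
by case: ifP => _ ->; rewrite ?mulr0 ?mul0r.
Qed.

Hypothesis Mreg : forall S, principal_mx S \in unitmx.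

Lemma scale_sum_mulmx1 (V : lmodType F) (A B : 'M[F]_n) (Y : 'I_n -> V) k :
  A *m B = 1%:M -> \sum_l A k l *: (\sum_j B l j *: Y j) = Y k.
Proof.
move=> AB1; under eq_bigr => l _ do rewrite scaler_sumr.
rewrite exchange_big /=.
have sumE j : \sum_l A k l *: (B l j *: Y j) = (k == j)%:R *: Y j.
  under eq_bigr => l _ do rewrite scalerA.
  by rewrite -scaler_suml; move/matrixP/(_ k j): AB1; rewrite !mxE => ->.
rewrite (bigD1 k) //= sumE eqxx scale1r big1 ?addr0 // => j jk.
by rewrite sumE eq_sym (negPf jk) scale0r.
Qed.

(** The main device below: identities between products x_k v, for all k at
    once, are proved by checking that their defects solve this system. *)
Lemma principal_system_uniq (V : lmodType F) S (Y : 'I_n -> V) :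
  (forall k, k \in S -> \sum_j M k j *: Y j = 0) ->
  (forall k, k \notin S -> Y k = 0) -> forall k, Y k = 0.
Proof.
move=> Yin Yout k.
have Y0 l : \sum_j principal_mx S l j *: Y j = 0.
  by rewrite principal_mxE; case: ifPn => lS; [exact: Yin | exact: Yout].
transitivity (\sum_l invmx (principal_mx S) k l *:
                \sum_j principal_mx S l j *: Y j); last first.
  by rewrite big1 // => l _; rewrite Y0 scaler0.
by rewrite scale_sum_mulmx1 // mulVmx.
Qed.

Definition monomial S : 'rV[F]_N := delta_mx 0 (enum_rank S).

(** Multiplication by x_k, acting on row vectors.  In the algebra the products
    Y_l = x_l x_S are x_(S + l) for l outside S and satisfy
    sum_j M k j Y_j = x_(S - k) for k in S; this is the linear system with
    matrix [principal_mx S] and right-hand side the toggled monomials. *)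
Definition mult k : 'M[F]_N :=
  \matrix_s \sum_l invmx (principal_mx (enum_val s)) k l *:
              monomial (toggle (enum_val s) l).

Lemma monomial_mult S k : monomial S *m mult k =
  \sum_l invmx (principal_mx S) k l *: monomial (toggle S l).
Proof. by rewrite -rowE rowK enum_rankK. Qed.

Lemma eq_on_monomials p (A B : 'M[F]_(N, p)) :
  (forall S, monomial S *m A = monomial S *m B) -> A = B.
Proof.
move=> eqAB; apply/row_matrixP => s; rewrite !rowE.
by have := eqAB (enum_val s); rewrite /monomial enum_valK.
Qed.

Lemma monomial_mult_system S k :
  (if k \in S then \sum_j M k j *: (monomial S *m mult j)
   else monomial S *m mult k) = monomial (toggle S k).
Proof.
rewrite -principal_mxE.
under eq_bigr => j _ do rewrite monomial_mult.
by rewrite scale_sum_mulmx1 // mulmxV.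
Qed.

Lemma monomial_mult_notin S k :
  k \notin S -> monomial S *m mult k = monomial (k |: S).
Proof.
by move=> kS; have := monomial_mult_system S k; rewrite /toggle (negPf kS).
Qed.

Lemma monomial_mult_in S k : k \in S ->
  \sum_j M k j *: (monomial S *m mult j) = monomial (S :\ k).
Proof. by move=> kS; have := monomial_mult_system S k; rewrite /toggle kS. Qed.

Lemma mult_comm_notin S k l : k \notin S -> l \notin S ->
  monomial S *m mult k *m mult l = monomial S *m mult l *m mult k.
Proof.
move=> kS lS; have [-> //|kl] := eqVneq k l.
rewrite (monomial_mult_notin kS) (monomial_mult_notin lS).
have lkS : l \notin k |: S by rewrite in_setU1 negb_or eq_sym kl.
have klS : k \notin l |: S by rewrite in_setU1 negb_or kl.
by rewrite (monomial_mult_notin lkS) (monomial_mult_notin klS) finset.setUCA.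
Qed.

(** The defect Z k l of commutation on x_S is antisymmetric.  For k outside S it
    solves the homogeneous system in l, by the relations for S and for S + k.
    For p, q in S both iterated sums of M p k M q l Z k l reduce to the
    monomial x_(S - p - q), so Z vanishes by uniqueness in each index. *)
Lemma monomial_mult_comm S k l :
  monomial S *m mult k *m mult l = monomial S *m mult l *m mult k.
Proof.
pose Z k l := monomial S *m mult k *m mult l - monomial S *m mult l *m mult k.
suff Z0 : forall k l, Z k l = 0 by apply/eqP; rewrite -subr_eq0; apply/eqP/Z0.
have sumZ p f : \sum_j M p j *: Z f j =
    monomial S *m mult f *m (\sum_j M p j *: mult j) -
    (\sum_j M p j *: (monomial S *m mult j)) *m mult f.
  rewrite mulmx_sumr mulmx_suml -sumrB; apply: eq_bigr => j _.
  by rewrite scalerBr -scalemxAr -scalemxAl.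
have ZN f g : Z f g = - Z g f by rewrite opprB.
have Zout f g : f \notin S -> Z f g = 0.
  move=> fS; move: g; apply: (@principal_system_uniq _ S) => [p pS|g gS].
    have fSp : f \notin S :\ p by rewrite in_setD1 negb_and fS orbT.
    have pfS : p \in f |: S by rewrite in_setU1 pS orbT.
    rewrite sumZ (monomial_mult_in pS) (monomial_mult_notin fS).
    rewrite (monomial_mult_notin fSp) mulmx_sumr.
    under eq_bigr => j _ do rewrite -scalemxAr.
    rewrite (monomial_mult_in pfS).
    apply/eqP; rewrite subr_eq0; apply/eqP; congr monomial.
    apply/finset.setP => i; rewrite !inE.
    by case: (eqVneq i f) => //= ->; case: eqVneq => // fp; rewrite fp pS in fS.
  by apply/eqP; rewrite subr_eq0; apply/eqP/mult_comm_notin.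
(* For fixed q, the vector sum_j M q j Z i j solves the system in i. *)
have ZMM p q : p \in S -> q \in S ->
    \sum_i M p i *: (\sum_j M q j *: Z i j) = 0.
  move=> pS qS.
  have -> : \sum_i M p i *: (\sum_j M q j *: Z i j) =
     monomial (S :\ p) *m (\sum_j M q j *: mult j)
     - monomial (S :\ q) *m (\sum_j M p j *: mult j).
    rewrite -(monomial_mult_in pS) -(monomial_mult_in qS).
    rewrite mulmx_suml [X in _ - X]mulmx_sumr -sumrB; apply: eq_bigr => i _.
    by rewrite sumZ scalerBr -scalemxAr -scalemxAl.
  have [->|pq] := eqVneq p q; first by rewrite subrr.
  rewrite !mulmx_sumr.
  under eq_bigr => j _ do rewrite -scalemxAr.
  under [X in _ - X]eq_bigr => j _ do rewrite -scalemxAr.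
  have qSp : q \in S :\ p by rewrite in_setD1 eq_sym pq.
  have pSq : p \in S :\ q by rewrite in_setD1 pq.
  rewrite (monomial_mult_in qSp) (monomial_mult_in pSq).
  apply/eqP; rewrite subr_eq0; apply/eqP; congr monomial.
  by apply/finset.setP => i; rewrite !inE andbCA.
move=> f; apply: (@principal_system_uniq _ S) => [q qS|g gS]; last first.
  by rewrite ZN Zout ?oppr0.
move: f; apply: (@principal_system_uniq _ S) => [p pS|f fS]; first exact: ZMM.
by rewrite big1 // => j _; rewrite Zout // scaler0.
Qed.

Lemma mult_comm k l : mult k *m mult l = mult l *m mult k.
Proof. by apply: eq_on_monomials => S; rewrite !mulmxA monomial_mult_comm. Qed.

(** It can be tested on monomials: one of the two factors adds k to S and the
    other one removes it, in an order that depends on whether k is in S. *)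
Lemma mult_quadric k : mult k *m (\sum_j M k j *: mult j) = 1%:M.
Proof.
apply: eq_on_monomials => S; rewrite mulmx1.
have sumE (v : 'rV[F]_N) : v *m (\sum_j M k j *: mult j) =
    \sum_j M k j *: (v *m mult j).
  by rewrite mulmx_sumr; apply: eq_bigr => j _; rewrite -scalemxAr.
case: (boolP (k \in S)) => kS; last first.
  rewrite mulmxA monomial_mult_notin // sumE monomial_mult_in ?inE ?eqxx //.
  by rewrite setU1K.
have -> : mult k *m (\sum_j M k j *: mult j) =
          (\sum_j M k j *: mult j) *m mult k.
  rewrite mulmx_sumr mulmx_suml; apply: eq_bigr => j _.
  by rewrite -scalemxAl -scalemxAr mult_comm.
rewrite mulmxA sumE monomial_mult_in // monomial_mult_notin ?inE ?eqxx //.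
by rewrite finset.setD1K.
Qed.

(** The linear form on the algebra evaluating polynomials at the point a. *)
Definition eval_vec a : 'cV[F]_N :=
  \col_(s < N) \prod_(k in (enum_val s : {set 'I_n})) a 0 k.

Lemma monomial_eval S a : monomial S *m eval_vec a = (\prod_(k in S) a 0 k)%:M.
Proof.
by apply/matrixP => i j; rewrite -rowE !mxE enum_rankK !ord1 eqxx mulr1n.
Qed.

Lemma mult_eval a k : solution a ->
  mult k *m eval_vec a = a 0 k *: eval_vec a.
Proof.
move=> aM; apply: eq_on_monomials => S; rewrite mulmxA -scalemxAr.
apply/eqP; rewrite -subr_eq0; apply/eqP; move: k.
apply: (@principal_system_uniq _ S) => k kS; last first.
  rewrite monomial_mult_notin // !monomial_eval.
  by rewrite big_setU1 //= scale_scalar_mx subrr.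
have -> : \sum_j M k j *: (monomial S *m mult j *m eval_vec a -
                           a 0 j *: (monomial S *m eval_vec a)) =
    (\sum_j M k j *: (monomial S *m mult j)) *m eval_vec a -
    (\sum_j M k j * a 0 j) *: (monomial S *m eval_vec a).
  rewrite mulmx_suml scaler_suml -sumrB; apply: eq_bigr => j _.
  by rewrite -scalemxAl scalerBr scalerA.
rewrite monomial_mult_in // !monomial_eval.
rewrite scale_scalar_mx (big_setD1 k kS) /= mulrA [_ * a 0 k]mulrC aM mul1r.
by rewrite subrr.
Qed.

(** Since x_S is obtained from 1 by multiplications, a common right eigenvector
    is determined by its value at 1. *)
Lemma mult_eigenvector b (z : 'cV[F]_N) :
  (forall k, mult k *m z = b 0 k *: z) ->
  z = eval_vec b *m (monomial finset.set0 *m z).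
Proof.
move=> zb; apply: eq_on_monomials => S.
rewrite (mulmxA _ (eval_vec b)) monomial_eval mul_scalar_mx.
have [m] := ubnP #|S|; elim: m S => // m IHm S.
have [->|[k kS]] := set_0Vmem S; first by rewrite big_set0 scale1r.
rewrite (cardsD1 k) kS ltnS => /IHm IH.
rewrite (big_setD1 k kS) /= -scalerA -IH -{1}(finset.setD1K kS).
by rewrite -monomial_mult_notin ?inE ?eqxx // -mulmxA zb -scalemxAr.
Qed.

(** Its inverse is the Gram matrix of the monomials for the bilinear
    form that sends (u, v) to the constant term of u v. *)
Definition minors : 'M[F]_N :=
  diag_mx (\row_s \det (principal_mx (enum_val s))).

Lemma minors_unit : minors \in unitmx.
Proof.
rewrite unitmxE det_diag unitfE; apply/prodf_neq0 => s _; rewrite mxE.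
by rewrite -unitfE -unitmxE Mreg.
Qed.

(** The two matrices differ only in row l, which the cofactor deletes.  This is
    the source of the self-adjointness of multiplication. *)
Lemma adj_principal_toggle S k l :
  (\adj (principal_mx (toggle S l))) k l = (\adj (principal_mx S)) k l.
Proof.
rewrite !mxE /cofactor; congr (_ * \det _); apply/matrixP => i j.
by rewrite !mxE in_toggle eq_sym (negPf (neq_lift _ _)).
Qed.

Lemma principal_mx0 : principal_mx finset.set0 = 1%:M.
Proof. by apply/matrixP => i j; rewrite !mxE inE. Qed.

(** Expand along row k, whose cofactors are those of the identity. *)
Lemma det_principal_mx1 k : \det (principal_mx [set k]%SET) = M k k.
Proof.
have adj_delta l : \adj (principal_mx [set k]%SET) l k = (l == k)%:R.
  have -> : [set k]%SET = toggle finset.set0 k.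
    by apply/finset.setP => i; rewrite in_toggle !inE addbF.
  by rewrite adj_principal_toggle principal_mx0 adj1 mxE.
rewrite (expand_det_row _ k) (bigD1 k) //= big1 ?addr0 => [|l lk].
  by have := adj_delta k; rewrite eqxx !mxE set11 => ->; rewrite mulr1.
by have := adj_delta l; rewrite (negPf lk) mxE => ->; rewrite mulr0.
Qed.

Lemma mult_entry k s t : \det (principal_mx (enum_val s)) * mult k s t =
  \sum_l (\adj (principal_mx (enum_val s))) k l *
         (enum_val t == toggle (enum_val s) l)%:R.
Proof.
rewrite mxE summxE mulr_sumr; apply: eq_bigr => l _.
rewrite /invmx Mreg !mxE mulrA mulVKf -?unitfE -?unitmxE ?Mreg // eqxx /=.
by rewrite -(inj_eq enum_rank_inj) enum_valK.
Qed.

(** By Cramer's rule the (S, T) entry of the product is zero unless S and T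
    differ in a single index l, and is then the (k, l) entry of the adjugate of
    [principal_mx S], which is the same for T. *)
Lemma minors_mult_sym k : minors *m mult k = (mult k)^T *m minors.
Proof.
apply/matrixP => s t.
rewrite mul_diag_mx mul_mx_diag [LHS]mxE [RHS]mxE [in LHS]mxE [in RHS]mulrC.
rewrite [(\row__ _) 0 t]mxE [in RHS](mxE _ _ s t) !mult_entry.
apply: eq_bigr => l _.
have -> : (enum_val s == toggle (enum_val t) l) =
          (enum_val t == toggle (enum_val s) l).
  by rewrite eq_sym (can2_eq (toggleK l) (toggleK l)).
by case: eqP => [->|_]; rewrite ?mulr0 // adj_principal_toggle.
Qed.

Lemma eval_minors_mult a k : solution a ->
  (eval_vec a)^T *m minors *m mult k = a 0 k *: ((eval_vec a)^T *m minors).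
Proof.
move=> aM; rewrite -mulmxA minors_mult_sym mulmxA -trmx_mul mult_eval //.
by rewrite linearZ -scalemxAl.
Qed.

Lemma minors_eval_orthogonal a b :
  solution a ->
  solution b ->
  a != b -> (eval_vec a)^T *m minors *m eval_vec b = 0.
Proof.
move=> aM bM ab; have [k abk] : exists k, a 0 k != b 0 k.
  by apply/existsP; apply: contraNT ab => /existsPn ab; apply/eqP/rowP => k;
     apply/eqP; rewrite -[_ == _]negbK.
apply/eqP; have := congr1 (mulmx^~ (eval_vec b)) (eval_minors_mult k aM).
rewrite /= -(mulmxA _ (mult k)) mult_eval // -scalemxAr -scalemxAl => /eqP.
by rewrite -subr_eq0 -scalerBl scaler_eq0 subr_eq0 eq_sym (negPf abk).
Qed.

(** Self-adjointness turns a left eigenvector into a right one, and these are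
    multiples of [eval_vec b]. *)
Lemma mult_left_eigenvector b (u : 'rV[F]_N) :
  (forall k, u *m mult k = b 0 k *: u) ->
  exists c : F, u = c *: ((eval_vec b)^T *m minors).
Proof.
move=> ub; pose z := invmx minors *m u^T.
have zb k : mult k *m z = b 0 k *: z.
  apply: (can_inj (mulKmx minors_unit)).
  rewrite mulmxA minors_mult_sym -mulmxA -scalemxAr /z !mulKVmx ?minors_unit //.
  by rewrite -trmx_mul ub linearZ.
exists ((monomial finset.set0 *m z) 0 0).
have zE := mult_eigenvector zb.
rewrite scalemxAl -linearZ /= -mul_mx_scalar -mx11_scalar -zE.
rewrite -{1}[u]trmxK -(mulKVmx minors_unit u^T) trmx_mul /minors tr_diag_mx.
by [].
Qed.

End QuotientAlgebra.

(** * The norm of an evaluation vector *)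

Section DeterminantExpansion.
Variables (F : fieldType) (n : nat) (M : 'M[F]_n).

(** Multilinearity in the rows: each row contributes either a row of M or a row
    of the identity. *)
Lemma det_diag_add_diag_mul (x y : 'rV[F]_n) :
  \det (diag_mx y + diag_mx x *m M) =
  \sum_(S : {set 'I_n}) (\prod_k (if k \in S then x 0 k else y 0 k)) *
     \det (principal_mx M S).
Proof.
transitivity (\sum_(s : 'S_n) \sum_(S : {set 'I_n}) (-1) ^+ s *
    \prod_i (if i \in S then x 0 i * M i (s i) else y 0 i * (i == s i)%:R)).
  apply: eq_bigr => s _; rewrite -mulr_sumr; congr (_ * _).
  under eq_bigr => i _ do rewrite mul_diag_mx !mxE -mulr_natr addrC.
  by rewrite bigA_distr; apply: eq_bigl => S; rewrite inE.
rewrite exchange_big; apply: eq_bigr => S _ /=.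
rewrite mulr_sumr; apply: eq_bigr => s _; rewrite mulrCA; congr (_ * _).
rewrite -big_split; apply: eq_bigr => i _ /=.
by rewrite mxE; case: ifP.
Qed.

Lemma det_one_add_diag_conj (a : 'rV[F]_n) : (forall k, a 0 k != 0) ->
  \det (1%:M + diag_mx a *m M *m diag_mx a) =
  \det (diag_mx (\row_k (a 0 k)^-1) + diag_mx a *m M) * \prod_k a 0 k.
Proof.
move=> a0; rewrite -det_diag -det_mulmx mulmxDl mulmx_diag.
congr (\det (_ + _)).
apply/matrixP => i j; rewrite !mxE; case: eqP => // _.
by rewrite mulVf.
Qed.

Lemma minors_eval_norm (a : 'rV[F]_n) : (forall k, a 0 k != 0) ->
  (eval_vec a)^T *m minors M *m eval_vec a =
  (\det (1%:M + diag_mx a *m M *m diag_mx a))%:M.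
Proof.
move=> a0; rewrite [LHS]mx11_scalar; congr (_%:M).
rewrite det_one_add_diag_conj // det_diag_add_diag_mul mulr_suml.
rewrite /minors mul_mx_diag mxE.
rewrite (reindex (@enum_rank _) (onW_bij _ (@enum_rank_bij _))) /=.
apply: eq_bigr => S _; rewrite !mxE enum_rankK -mulrAC [RHS]mulrAC.
congr (_ * _).
rewrite big_mkcond -!big_split; apply: eq_bigr => k _ /=.
by rewrite mxE; case: ifP => _; rewrite ?mulr1 // mulVf.
Qed.

End DeterminantExpansion.

(** * Resolution of the identity by evaluation vectors *)

Lemma common_eigenvector_stable (C : numClosedFieldType) (N : nat)
    (I : finType) (X : I -> 'M[C]_N) (P : 'M[C]_N) :
  (forall i j, X i *m X j = X j *m X i) ->
  P != 0 -> (forall i, stablemx P (X i)) ->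
  exists u : 'rV[C]_N, [/\ u != 0, (u <= P)%MS &
    exists b : I -> C, forall i, u *m X i = b i *: u].
Proof.
move=> Xcomm P0 PX.
have rP : (0 < \rank P)%N by rewrite lt0n mxrank_eq0.
have [|v v0 /allP /= vX] := @common_eigenvector C _
    [seq conjmx (row_base P) (X i) | i <- enum I] rP.
  move=> _ _ /mapP[i _ ->] /mapP[j _ ->]; rewrite /comm_mx.
  by rewrite -!conjmxM ?inE ?stablemx_row_base // Xcomm.
exists (v *m row_base P); split.
- by rewrite mulmx_free_eq0 // row_base_free.
- by rewrite mulmx_sub // eq_row_base.
suff uX i : exists b, v *m row_base P *m X i = b *: (v *m row_base P).
  by exists (fun i => projT1 (cid (uX i))) => i; case: cid.
apply/sub_rVP; have := vX _ (map_f _ (mem_enum I i)).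
by rewrite stablemx_restrict.
Qed.

Section Resolution.
Variables (C : numClosedFieldType) (n : nat) (M : 'M[C]_n).
Hypothesis Mreg : forall S, principal_mx M S \in unitmx.


Lemma solution_neq0 a : solution M a -> forall k, a 0 k != 0.
Proof.
move=> aI k; apply/eqP => ak0; have := aI k.
by rewrite ak0 mul0r => /esym/eqP; rewrite oner_eq0.
Qed.

Lemma joint_eigenvalue (u : 'rV[C]_#|{set 'I_n}|) (b : 'rV[C]_n) :
  u != 0 -> (forall k, u *m mult M k = b 0 k *: u) -> solution M b.
Proof.
move=> u0 ub k; have := congr1 (mulmx u) (mult_quadric Mreg k).
rewrite mulmxA ub mulmx1 -scalemxAl mulmx_sumr.
under eq_bigr => j _ do rewrite -scalemxAr ub scalerA.
rewrite -scaler_suml scalerA => /eqP.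
by rewrite -subr_eq0 -{2}[u]scale1r -scalerBl scaler_eq0 (negPf u0) orbF
  subr_eq0 => /eqP.
Qed.

(** The left-hand side projects onto the span of the evaluation vectors and
    commutes with multiplication.  A common left eigenvector in the image of the
    complementary projection is, up to a scalar, dual to some [eval_vec b], yet
    kills all evaluation vectors; this contradicts the norm being nonzero. *)
Lemma eval_resolution (s : seq 'rV[C]_n) :
  uniq s -> (forall a, a \in s <-> solution M a) ->
  (forall a, solution M a -> \det (1%:M + diag_mx a *m M *m diag_mx a) != 0) ->
  \sum_(a <- s) (1 / \det (1%:M + diag_mx a *m M *m diag_mx a)) *:
     (eval_vec a *m (eval_vec a)^T) *m minors M = 1%:M.
Proof.
move=> us sI Inz; set Q := \sum_(a <- s) _.
have QX k : Q *m mult M k = mult M k *m Q.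
  rewrite mulmx_suml mulmx_sumr; apply: eq_big_seq => a /sI aI.
  rewrite -!scalemxAl -scalemxAr; congr (_ *: _).
  have -> : eval_vec a *m (eval_vec a)^T *m minors M *m mult M k =
      eval_vec a *m ((eval_vec a)^T *m minors M *m mult M k) by rewrite !mulmxA.
  have -> : mult M k *m (eval_vec a *m (eval_vec a)^T *m minors M) =
      mult M k *m eval_vec a *m ((eval_vec a)^T *m minors M) by rewrite !mulmxA.
  by rewrite eval_minors_mult // mult_eval // -scalemxAr -scalemxAl.
have assoc a b : eval_vec a *m (eval_vec a)^T *m minors M *m eval_vec b =
    eval_vec a *m ((eval_vec a)^T *m minors M *m eval_vec b) by rewrite !mulmxA.
have Qeval b : b \in s -> Q *m eval_vec b = eval_vec b.
  move=> bs; have /sI bI := bs.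
  rewrite mulmx_suml (bigD1_seq b) //= big_seq_cond big1.
    rewrite addr0 -!scalemxAl assoc minors_eval_norm; last exact: solution_neq0.
    by rewrite mul_mx_scalar scalerA mul1r mulVf ?scale1r // Inz.
  move=> a /andP[/sI aI ab]; rewrite -!scalemxAl assoc.
  by rewrite minors_eval_orthogonal // mulmx0 scaler0.
apply/eqP; rewrite eq_sym -subr_eq0; apply/negPn/negP => P0.
have PX k : stablemx (1%:M - Q) (mult M k).
  by apply: comm_mx_stable; rewrite /comm_mx mulmxBl mulmxBr mul1mx mulmx1 QX.
have [u [u0 /submxP[v uP] [b0 ub0]]] :=
  common_eigenvector_stable (mult_comm Mreg) P0 PX.
pose b := \row_k b0 k.
have ub k : u *m mult M k = b 0 k *: u by rewrite mxE.
have bI := joint_eigenvalue u0 ub.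
have ueval : u *m eval_vec b = 0.
  by rewrite uP -mulmxA mulmxBl mul1mx Qeval ?subrr ?mulmx0 //; apply/sI.
have [c uE] := mult_left_eigenvector Mreg ub.
move: ueval; rewrite uE -scalemxAl.
rewrite minors_eval_norm ?scale_scalar_mx; last exact: solution_neq0.
move=> /matrixP/(_ 0 0); rewrite !mxE eqxx mulr1n => /eqP.
rewrite mulf_eq0 (negPf (Inz _ bI)) orbF => /eqP c0.
by move: u0; rewrite uE c0 scale0r eqxx.
Qed.

Lemma weighted_monomial_orthogonality (s : seq 'rV[C]_n) :
  uniq s -> (forall a, a \in s <-> solution M a) ->
  (forall a, solution M a -> \det (1%:M + diag_mx a *m M *m diag_mx a) != 0) ->
  forall S T : {set 'I_n},
  \sum_(a <- s) (1 / \det (1%:M + diag_mx a *m M *m diag_mx a)) *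
     (\prod_(k in S) a 0 k * \prod_(k in T) a 0 k) =
  (S == T)%:R / \det (principal_mx M T).
Proof.
move=> us sI Inz S T.
have /matrixP/(_ (enum_rank S) (enum_rank T)) := eval_resolution us sI Inz.
rewrite -mulmx_suml /minors mul_mx_diag !mxE summxE (inj_eq enum_rank_inj).
rewrite enum_rankK => <-; rewrite mulfK -?unitfE -?unitmxE //.
apply: eq_bigr => a _; rewrite [RHS]mxE; congr (_ * _).
by rewrite mxE big_ord1 !mxE !enum_rankK.
Qed.

(** The coordinates of a solution are eigenvalues of the [mult k]. *)
Lemma finite_solutions : finite_set [set a | solution M a].
Proof.
have [r rP] : exists r : seq C, forall a k, solution M a -> a 0 k \in r.
  have rk k : exists r : seq C, forall a, solution M a -> a 0 k \in r.
    have [r rE] := closed_field_poly_normal (char_poly (mult M k)^T).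
    exists r => a aI; rewrite -root_prod_XsubC.
    have : root (char_poly (mult M k)^T) (a 0 k).
      rewrite -eigenvalue_root_char; apply/eigenvalueP; exists (eval_vec a)^T.
        by rewrite -trmx_mul mult_eval // linearZ.
      apply/eqP => /rowP/(_ (enum_rank finset.set0)); rewrite !mxE enum_rankK.
      by rewrite big_set0 => /eqP; rewrite oner_eq0.
    by rewrite rE rootZ // lead_coef_eq0 -size_poly_gt0 size_char_poly.
  exists (flatten [seq projT1 (cid (rk k)) | k <- enum 'I_n]) => a k aI.
  apply/flattenP; exists (projT1 (cid (rk k))).
    by rewrite map_f ?mem_enum.
  by case: cid => r /=; apply.
pose f (g : {ffun 'I_n -> 'I_(size r)}) : 'rV[C]_n := \row_k r`_(g k).
apply: (@sub_finite_set _ _ (range f)); last exact/finite_image/finite_finset.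
move=> a aI.
have aidx k : (index (a 0%R k) r < size r)%N by rewrite index_mem rP.
exists [ffun k => Ordinal (aidx k)] => //.
by apply/rowP => k; rewrite mxE ffunE /= nth_index // rP.
Qed.

End Resolution.

(** * The Jacobian determinant *)

Section Jacobian.
Variables (K : numFieldType) (n : nat) (M : 'M[K]_n).
Implicit Types (a v : 'rV[K]_n).

Definition entry k (x : 'rV[K]_n) : K := x 0 k.

Lemma differentiable_entry a k : differentiable (entry k) a.
Proof. exact: differentiable_coord. Qed.

Lemma is_derive_entry a v k : is_derive a v (entry k) (v 0 k).
Proof.
have lin : linear (entry k) by move=> c x y; rewrite /entry !mxE.
pose linM := GRing.isLinear.Build _ _ _ _ _ lin.
pose f : {linear 'rV[K]_n -> K} := HB.pack (entry k) linM.
have fcont : continuous f by exact: coord_continuous.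
apply: DeriveDef; first exact/diff_derivable/differentiable_entry.
rewrite deriveE; last exact: differentiable_entry.
by rewrite (@diff_lin _ _ _ f a fcont).
Qed.

(** Written with the ring operations of function spaces, the shape to which the
    differentiation rules apply. *)
Definition quadric_coord k : 'rV[K]_n -> K :=
  entry k * (\sum_j (M k j \*: entry j)) - cst 1.

Lemma differentiable_quadric_coord a k : differentiable (quadric_coord k) a.
Proof.
apply: differentiableB; last exact: differentiable_cst.
apply: differentiableM; first exact: differentiable_entry.
apply: differentiable_sum => j; apply: differentiableZ.
exact: differentiable_entry.
Qed.

Lemma derive_quadric_coord a v k : 'D_v (quadric_coord k) a =
  a 0 k * (\sum_j M k j * v 0 j) + (\sum_j M k j * a 0 j) * v 0 k.
Proof.
have dc := is_derive_entry a v.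
have dL : is_derive a v (\sum_j (M k j \*: entry j))
    (\sum_j M k j *: v 0 j).
  by apply: is_derive_sum => j; exact: is_deriveZ.
have dI := is_deriveB (is_deriveM (dc k) dL) (is_derive_cst (1 : K) a v).
by rewrite derive_val subr0 fct_sumE.
Qed.

(** The map f_M of which the theorem takes the case K = R[i]. *)
Definition quadric_map (x : 'rV[K]_n) : 'rV[K]_n :=
  \row_k (x 0 k * (\sum_j M k j * x 0 j) - 1).

Lemma quadric_map_sum : quadric_map =
  \sum_k (fun x => quadric_coord k x *: delta_mx 0 k).
Proof.
apply/funext => x; rewrite fct_sumE [LHS]row_sum_delta.
apply: eq_bigr => k _; rewrite mxE; congr (_ *: _).
rewrite /quadric_coord /=; congr (_ * _ - _).
by rewrite fct_sumE.
Qed.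

Lemma jacobian_quadric_map a : 'J (quadric_map) a =
  (diag_mx (\row_k \sum_j M k j * a 0 j) + diag_mx a *m M)^T.
Proof.
have dk k :
    differentiable (fun x => quadric_coord k x *: delta_mx 0 k : 'rV_n) a.
  exact/differentiableZl/differentiable_quadric_coord.
have df : differentiable (quadric_map) a.
  by rewrite quadric_map_sum; apply: differentiable_sum.
apply/row_matrixP => i; rewrite rowE -deriveEjacobian // quadric_map_sum.
rewrite derive_sum => [|k]; last exact: diff_derivable.
apply/rowP => k; rewrite summxE (bigD1 k) //= big1 ?addr0 => [|l lk].
  rewrite deriveE // diffZl; last exact: differentiable_quadric_coord.
  rewrite -deriveE; last exact: differentiable_quadric_coord.
  rewrite derive_quadric_coord mul_diag_mx !mxE !eqxx /= mulr1 [RHS]addrC.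
  rewrite mulr_natr; congr (_ * _ + _).
  rewrite (bigD1 i) //= mxE !eqxx mulr1 big1 ?addr0 // => j ji.
  by rewrite mxE (negPf ji) andbF mulr0.
rewrite deriveE // diffZl; last exact: differentiable_quadric_coord.
by rewrite !mxE eq_sym (negPf lk) andbF mulr0.
Qed.

End Jacobian.

(** * Properness *)

Section Proper.
Variables (R : realType) (n : nat).

Lemma hnormZ (t : R[i]) (x : 'rV[R[i]]_n) :
  hnorm (t *: x) = ComplexField.Normc.normc t * hnorm x.
Proof.
rewrite /hnorm.
under eq_bigr => k _ do rewrite mxE ComplexField.Normc.normcM exprMn.
rewrite -mulr_sumr sqrtrM ?sqr_ge0 // sqrtr_sqr ger0_norm //.
by case: t => re im; exact: sqrtr_ge0.
Qed.

Lemma hnorm_eq0 (x : 'rV[R[i]]_n) : hnorm x = 0 -> x = 0.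
Proof.
move=> /eqP; rewrite sqrtr_eq0 => x0.
have sqr0 k : 0 <= ComplexField.Normc.normc (x 0 k) ^+ 2 by exact: sqr_ge0.
apply/rowP => k; rewrite mxE; apply: ComplexField.Normc.eq0_normc.
apply/eqP; rewrite -sqrf_eq0 eq_le sqr0 andbT; apply: le_trans x0.
by rewrite (bigD1 k) //= lerDl sumr_ge0.
Qed.

(** Along the line spanned by a nonzero common zero of the forms x_k (Mx)_k the
    map is constant, which properness forbids. *)
Lemma proper_no_isotropic (M : 'M[R[i]]_n) : proper_mx M ->
  forall x : 'rV_n, (forall k, x 0 k * (\sum_j M k j * x 0 j) = 0) -> x = 0.
Proof.
move=> properM x x0; apply: contrapT => /eqP xn0.
have hx : 0 < hnorm x.
  rewrite lt_neqAle sqrtr_ge0 andbT eq_sym; apply: contra xn0 => /eqP.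
  by move/hnorm_eq0 ->.
have [B hB] := properM (hnorm (const_mx (-1) : 'rV[R[i]]_n) + 1).
pose t := `|B| / hnorm x.
have t0 : 0 <= t by rewrite divr_ge0 // ltW.
have tB : B <= hnorm (t%:C *: x).
  rewrite hnormZ /= expr0n addr0 sqrtr_sqr ger0_norm // divfK ?gt_eqF //.
  exact: ler_norm.
have := hB _ tB.
have -> : inveig_map M (t%:C *: x) = const_mx (-1).
  apply/rowP => k; rewrite !mxE.
  under eq_bigr => j _ do rewrite mxE mulrCA.
  by rewrite -mulr_sumr mulrACA x0 mulr0 sub0r.
by rewrite gerDl ler10.
Qed.

End Proper.

(** * The weighted sums over inverse eigenvectors *)

Theorem theorem1 (R : realType) (n : nat) (M : 'M[R[i]]_n)
    (hn : (2 <= n)%N) (hT : transverse_mx M) (hP : proper_mx M)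
    (hdiag : forall k, M k k = 1) :
  \sum_(a \in inverse_eigenvectors M) inveig_weight M a = 1 /\
  \sum_(a \in inverse_eigenvectors M) inveig_weight M a *: outer a a = 1%:M.
Proof.
have Mreg S : principal_mx M S \in unitmx.
  exact/principal_mx_unit/proper_no_isotropic.
have Ifin : finite_set (inverse_eigenvectors M).
  exact: finite_solutions Mreg.
have Inz a : inverse_eigenvectors M a ->
    \det (1%:M + diag_mx a *m M *m diag_mx a) != 0.
  move=> aI; have a0 := solution_neq0 aI.
  rewrite det_one_add_diag_conj // mulf_neq0 //; last exact/prodf_neq0.
  have := hT a; rewrite inE => /(_ aI); rewrite jacobian_quadric_map det_tr.
  have -> // : \row_k (a 0 k)^-1 = \row_k \sum_j M k j * a 0 j.
  by apply/rowP => k; rewrite !mxE -[RHS](mulKf (a0 k)) aI mulr1.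
pose s := fset_set (inverse_eigenvectors M).
have sI a : a \in finmap.enum_fset s <-> inverse_eigenvectors M a.
  by rewrite in_fset_set // inE.
have dual := weighted_monomial_orthogonality Mreg (finmap.fset_uniq s) sI Inz.
rewrite !fsbig_finite //; split.
  have := dual finset.set0 finset.set0; rewrite eqxx.
  rewrite principal_mx0 det1 divr1 => dual00.
  apply: etrans dual00; apply: eq_bigr => a _.
  by rewrite !big_set0 !mulr1.
apply/matrixP => i j; rewrite summxE.
have := dual [set i]%SET [set j]%SET.
rewrite det_principal_mx1 hdiag.
rewrite divr1 (inj_eq finset.set1_inj) => dualij.
rewrite [RHS]mxE; apply: etrans dualij; apply: eq_bigr => a _.
rewrite !big_set1 mxE; congr (_ * _).
by rewrite mxE big_ord1 mxE.
Qed.
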